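(* The partial fields $\mathbb{H}_5$ and $\mathbb{U}_3$ are isomorphic. In particular, a matroid is $3$-regular if and only if it is $\mathbb{H}_5$-representable.
   Context: A partial field is a pair $\mathbb{P}=(R,G)$, where $R$ is a commutative ring with unity and $G$ is a subgroup of the group of units of $R$ with $-1\in G$. Write $p\in\mathbb{P}$ if $p\in G\cup\{0\}$. A function $\phi:\mathbb{P}_1\to\mathbb{P}_2$ between partial fields is a homomorphism if $\phi(1)=1$; $\phi(pq)=\phi(p)\phi(q)$ for all $p,q\in\mathbb{P}_1$; and $\phi(p)+\phi(q)=\phi(p+q)$ for all $p,q\in\mathbb{P}_1$ with $p+q\in\mathbb{P}_1$. Two partial fields are isomorphic if there is a bijective homomorphism between them whose inverse is also a homomorphism. The $3$-regular partial field is $\mathbb{U}_3=(\mathbb{Q}(\alpha_1,\alpha_2,\alpha_3),\langle -1,\alpha_1,\alpha_2,\alpha_3,\alpha_1-1,\alpha_2-1,\alpha_3-1,\alpha_1-\alpha_2,\alpha_1-\alpha_3,\alpha_2-\alpha_3\rangle)$ with $\alpha_1,\alpha_2,\alpha_3$ indeterminates. The Hydra-5 partial field is $\mathbb{H}_5=(\mathbb{Q}(\alpha,\beta,\gamma),\langle -1,\alpha,\beta,\gamma,1-\alpha,1-\beta,1-\gamma,\alpha-\gamma,\gamma-\alpha\beta,1-\gamma-(1-\alpha)\beta\rangle)$ with $\alpha,\beta,\gamma$ indeterminates. Here $\langle\cdot\rangle$ denotes the generated multiplicative group. A $\mathbb{P}$-matrix is a matrix over $R$ all of whose non-zero subdeterminants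 are in $G$. A matroid is $\mathbb{P}$-representable if it equals $M[I|A]$ for some $X\times Y$ $\mathbb{P}$-matrix $A$ ($X\cap Y=\emptyset$), where $M[I|A]$ has ground set $X\cup Y$ and bases $X$ and all $X\triangle Z$ with $|X\cap Z|=|Y\cap Z|$ and $\det(A[X\cap Z,Y\cap Z])\neq 0$. A matroid is $3$-regular if it is $\mathbb{U}_3$-representable. *)

(* Defs.v *)
From HB Require Import structures.
From mathcomp Require Import all_boot all_order all_algebra.
From mathcomp Require Import mpoly.

Set Implicit Arguments.
Unset Strict Implicit.
Unset Printing Implicit Defensive.

Import GRing.Theory.
Local Open Scope ring_scope.

(** * Partial fields *)

(* [pf_groupV] makes [pf_group] a subgroup of the units without requiring the
   ring to have a decidable unit predicate. *)
Record partial_field := PartialField {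
  pf_ring : comPzRingType;
  pf_group : pf_ring -> Prop;
  pf_group1 : pf_group 1;
  pf_groupM : forall x y, pf_group x -> pf_group y -> pf_group (x * y);
  pf_groupV : forall x, pf_group x -> exists2 y, pf_group y & x * y = 1;
  pf_groupN1 : pf_group (-1)
}.

Definition pf_in (P : partial_field) (x : pf_ring P) : Prop :=
  pf_group x \/ x = 0.

(* A partial field is identified with the subset G :|: {0} of its ring. *)
Definition pf_elt (P : partial_field) : Type := {x : pf_ring P | pf_in x}.
Coercion pf_elt : partial_field >-> Sortclass.

Definition pf_val (P : partial_field) (p : P) : pf_ring P := sval p.

Definition pf_one (P : partial_field) : P :=
  exist _ 1 (or_introl (pf_group1 P)).

Lemma pf_inM (P : partial_field) (x y : pf_ring P) :
  pf_in x -> pf_in y -> pf_in (x * y).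
Proof.
case=> [Gx|->]; last by right; rewrite mul0r.
by case=> [Gy|->]; [left; apply: pf_groupM | right; rewrite mulr0].
Qed.

Definition pf_mul (P : partial_field) (p q : P) : P :=
  exist _ (pf_val p * pf_val q) (pf_inM (svalP p) (svalP q)).

(* The addition of a partial field is partial: the last clause is only about
   those p, q whose sum in the ring is again (the value of) an element r. *)
Definition pf_hom (P1 P2 : partial_field) (phi : P1 -> P2) : Prop :=
  [/\ phi (pf_one P1) = pf_one P2,
      forall p q : P1, phi (pf_mul p q) = pf_mul (phi p) (phi q)
    & forall p q r : P1, pf_val p + pf_val q = pf_val r ->
        pf_val (phi p) + pf_val (phi q) = pf_val (phi r)].

Definition pf_isomorphic (P1 P2 : partial_field) : Prop :=
  exists (phi : P1 -> P2) (psi : P2 -> P1),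
    [/\ cancel phi psi, cancel psi phi, pf_hom phi & pf_hom psi].

(** * Matrices over a partial field *)

Definition submatrix (R : Type) (m n : nat) (A : 'M[R]_(m, n))
    (I : {set 'I_m}) (J : {set 'I_n}) (eqIJ : #|I| = #|J|) : 'M[R]_#|I| :=
  \matrix_(i, j) A (enum_val i) (enum_val (cast_ord eqIJ j)).

Definition pf_matrix (P : partial_field) (m n : nat)
    (A : 'M[pf_ring P]_(m, n)) : Prop :=
  forall (I : {set 'I_m}) (J : {set 'I_n}) (eqIJ : #|I| = #|J|),
    \det (submatrix A eqIJ) != 0 -> pf_group (\det (submatrix A eqIJ)).

(** * Matroids *)

Record matroid (E : finType) := Matroid {
  bases : {set {set E}};
  bases_neq0 : bases != set0;
  bases_exchange : forall B1 B2 : {set E}, B1 \in bases -> B2 \in bases ->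
    forall x, x \in B1 :\: B2 ->
      exists2 y, y \in B2 :\: B1 & (y |: (B1 :\ x)) \in bases
}.

Definition symdiff (E : finType) (X Z : {set E}) : {set E} :=
  (X :\: Z) :|: (Z :\: X).

(* An X x Y matrix is a matrix of size #|X| x #|Y|, the label of index i being
   [enum_val i]; [indices X Z] is then the set of indices labelled by the
   elements of X :&: Z, so it has cardinality #|X :&: Z|. *)
Definition indices (E : finType) (X Z : {set E}) : {set 'I_#|X|} :=
  [set i | enum_val i \in Z].

Definition basis_of_IA (R : comPzRingType) (E : finType) (X Y : {set E})
    (A : 'M[R]_(#|X|, #|Y|)) (B : {set E}) : Prop :=
  B = X \/
  exists (Z : {set E}) (eqZ : #|indices X Z| = #|indices Y Z|),
    B = symdiff X Z /\ \det (submatrix A eqZ) != 0.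

Definition representable (P : partial_field) (E : finType) (M : matroid E) :
    Prop :=
  exists (X Y : {set E}) (A : 'M[pf_ring P]_(#|X|, #|Y|)),
    [/\ [disjoint X & Y], X :|: Y = [set: E], pf_matrix A
      & forall B : {set E}, B \in bases M <-> basis_of_IA A B].

(** * Partial fields given by generators *)

Inductive generated (F : fieldType) (S : seq F) : F -> Prop :=
| generated_mem x : x \in S -> generated S x
| generated1 : generated S 1
| generatedM x y : generated S x -> generated S y -> generated S (x * y)
| generatedV x : generated S x -> generated S x^-1.

Lemma generated_neq0 (F : fieldType) (S : seq F) (x : F) :
  0 \notin S -> generated S x -> x != 0.
Proof.
move=> S0; elim=> {x} [x Sx||x y _ x0 _ y0|x _ x0].
- by apply: contraNneq S0 => <-.
- exact: oner_neq0.
- by rewrite mulf_neq0.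
- by rewrite invr_eq0.
Qed.

Lemma generated_inv (F : fieldType) (S : seq F) (S0 : 0 \notin S) (x : F) :
  generated S x -> exists2 y, generated S y & x * y = 1.
Proof.
move=> Sx; exists x^-1; first exact: generatedV.
by rewrite mulfV // (generated_neq0 S0).
Qed.

Definition generated_pf (F : fieldType) (S : seq F) (S0 : 0 \notin S)
    (SN1 : -1 \in S) : partial_field :=
  @PartialField F (generated S) (@generated1 F S) (@generatedM F S)
    (generated_inv S0) (generated_mem SN1).

(** * The 3-regular and Hydra-5 partial fields *)

Definition ratfun3 : fieldType := {fraction {mpoly rat[3]}}.

Definition indet (i : 'I_3) : ratfun3 := tofrac 'X_i.

Definition U3_gens : seq ratfun3 :=
  let a1 := indet (inord 0) in
  let a2 := indet (inord 1) in
  let a3 := indet (inord 2) in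
  [:: -1; a1; a2; a3; a1 - 1; a2 - 1; a3 - 1; a1 - a2; a1 - a3; a2 - a3].

Definition H5_gens : seq ratfun3 :=
  let a := indet (inord 0) in
  let b := indet (inord 1) in
  let c := indet (inord 2) in
  [:: -1; a; b; c; 1 - a; 1 - b; 1 - c; a - c; c - a * b;
      1 - c - (1 - a) * b].

(* To show that a polynomial is nonzero, evaluate it at (2, 3, 5). *)
Definition test_point (i : 'I_3) : rat := [:: 2; 3; 5]`_i.

Lemma tofrac_neq0 (p : {mpoly rat[3]}) :
  meval test_point p != 0 -> tofrac p != 0 :> ratfun3.
Proof. by rewrite tofrac_eq0; apply: contraNneq => ->; rewrite meval0. Qed.

Lemma U3_gens_neq0 : 0 \notin U3_gens.
Proof.
rewrite /U3_gens /indet -tofrac1 -!(tofracN, tofracD).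
rewrite !inE ![0 == _]eq_sym !negb_or.
do ?[apply/andP; split]; apply: tofrac_neq0;
  by rewrite ?(mevalN, mevalD, mevalXU, meval1) /test_point ?inordK.
Qed.

Lemma H5_gens_neq0 : 0 \notin H5_gens.
Proof.
rewrite /H5_gens /indet -tofrac1 -!(tofracN, tofracD, tofracM).
rewrite !inE ![0 == _]eq_sym !negb_or.
do ?[apply/andP; split]; apply: tofrac_neq0;
  by rewrite ?(mevalN, mevalD, mevalM, mevalXU, meval1) /test_point ?inordK.
Qed.

Definition U3 : partial_field :=
  generated_pf U3_gens_neq0 (mem_head (-1) (behead U3_gens)).

Definition H5 : partial_field :=
  generated_pf H5_gens_neq0 (mem_head (-1) (behead H5_gens)).

Definition three_regular (E : finType) (M : matroid E) : Prop :=
  representable U3 M.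

(* Main.v *)
(** The isomorphism is induced by an automorphism of the field of rational
    functions, namely the birational change of variables
    [alpha = (a2 - 1) / (a2 - a1)], [beta = a3],
    [gamma = a1 (a2 - 1) / (a2 - a1)], with inverse [a1 = gamma / alpha],
    [a2 = (1 - gamma) / (1 - alpha)], [a3 = beta].  Both substitutions send
    generators to products of generators and their inverses.  An injective ring
    morphism preserving the groups commutes with subdeterminants and preserves
    their vanishing, so it also transports representations of matroids. *)

From HB Require Import structures.
From Stdlib Require Import ProofIrrelevance.
Require Import Defs.
From mathcomp Require Import all_boot all_order all_algebra.
From mathcomp Require Import mpoly ring.

Set Implicit Arguments.
Unset Strict Implicit.
Unset Printing Implicit Defensive.

Import GRing.Theory.
Local Open Scope ring_scope.

(** Membership in [P] is an arbitrary proposition, so proof irrelevance is what identifies elements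
    with equal values. *)
Lemma pf_val_inj (P : partial_field) : injective (@pf_val P).
Proof. by move=> [x Px] [y Py] /= xy; apply: subset_eq_compat. Qed.

(** * Transport of homomorphisms and matroid representations along ring morphisms *)

Section GroupMorphism.
Variables (P1 P2 : partial_field) (f : {rmorphism pf_ring P1 -> pf_ring P2}).
Hypothesis fG : forall x, pf_group x -> pf_group (f x).

Lemma pf_in_rmorph x : pf_in x -> pf_in (f x).
Proof. by case=> [/fG|->]; [left | right; rewrite rmorph0]. Qed.

Definition pf_map (p : P1) : P2 :=
  exist _ (f (pf_val p)) (pf_in_rmorph (svalP p)).

Lemma pf_map_hom : pf_hom pf_map.
Proof.
split=> [|p q|p q r pqr].
- exact/pf_val_inj/(rmorph1 f).
- exact/pf_val_inj/(rmorphM f).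
- by rewrite /pf_val /= -rmorphD; congr (f _).
Qed.

Lemma submatrix_map m n (A : 'M_(m, n)) (I : {set 'I_m}) (J : {set 'I_n})
    (eqIJ : #|I| = #|J|) :
  submatrix (map_mx f A) eqIJ = map_mx f (submatrix A eqIJ).
Proof. by apply/matrixP=> i j; rewrite !mxE. Qed.

Hypothesis f_inj : injective f.

Lemma det_submatrix_map_neq0 m n (A : 'M_(m, n)) (I : {set 'I_m})
    (J : {set 'I_n}) (eqIJ : #|I| = #|J|) :
  (\det (submatrix (map_mx f A) eqIJ) != 0) = (\det (submatrix A eqIJ) != 0).
Proof. by rewrite submatrix_map det_map_mx -(inj_eq f_inj) rmorph0. Qed.

(** Apply [f] to every entry and keep [X] and [Y]: the bases depend only on which subdeterminants
    vanish, and injectivity preserves that. *)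
Lemma representable_rmorph (E : finType) (M : matroid E) :
  representable P1 M -> representable P2 M.
Proof.
move=> [X [Y [A [XY0 XYE A_P1 MA]]]]; exists X, Y, (map_mx f A); split=> //.
  move=> I J eqIJ; rewrite det_submatrix_map_neq0 => /A_P1 /fG.
  by rewrite submatrix_map det_map_mx.
move=> B; rewrite MA; split=> -[->|[Z [eqZ [-> dZ]]]]; first by left.
- by right; exists Z, eqZ; rewrite det_submatrix_map_neq0.
- by left.
- by right; exists Z, eqZ; rewrite -det_submatrix_map_neq0.
Qed.

End GroupMorphism.

Lemma pf_isomorphic_rmorph (P1 P2 : partial_field)
    (f : {rmorphism pf_ring P1 -> pf_ring P2})
    (g : {rmorphism pf_ring P2 -> pf_ring P1}) :
  (forall x, pf_group x -> pf_group (f x)) ->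
  (forall x, pf_group x -> pf_group (g x)) ->
  cancel f g -> cancel g f -> pf_isomorphic P1 P2.
Proof.
move=> fG gG fK gK; exists (pf_map fG), (pf_map gG).
by split; [move=> p; apply/pf_val_inj/fK | move=> p; apply/pf_val_inj/gK
         | apply: pf_map_hom | apply: pf_map_hom].
Qed.

Lemma generated_rmorph (F L : fieldType) (f : {rmorphism F -> L})
    (S : seq F) (T : seq L) :
  (forall x, x \in S -> generated T (f x)) ->
  forall x, generated S x -> generated T (f x).
Proof.
move=> fS x; elim=> {x} [x /fS //||x y _ Tx _ Ty|x _ Tx].
- by rewrite rmorph1; apply: generated1.
- by rewrite rmorphM; apply: generatedM.
- by rewrite fmorphV; apply: generatedV.
Qed.

(** * Extension of ring morphisms to the fraction field *)

Section FractionLift.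
Variable R : idomainType.
Implicit Types (x y : {fraction R}) (p q : R).

(** Read off a chosen representative, so these need not respect the ring operations; computations go
    through [mul_fden]. *)
Definition fnum x : R := (frac (repr x)).1.
Definition fden x : R := (frac (repr x)).2.

Lemma fden_neq0 x : fden x != 0.
Proof. exact: denom_ratioP. Qed.

Lemma mul_fden x : x * tofrac (fden x) = tofrac (fnum x).
Proof.
rewrite /fnum /fden -{1}[x]reprK; unlock FracField.tofrac.
rewrite -[LHS]FracField.pi_mul /FracField.mulf.
apply/eqP; rewrite FracField.equivf_def.
by rewrite !numden_Ratio ?(oner_neq0, mulr1, denom_ratioP) // mulrC.
Qed.

Lemma fraction_quotient x : x = tofrac (fnum x) / tofrac (fden x).
Proof. by rewrite -mul_fden mulfK // tofrac_eq0 fden_neq0. Qed.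

Variables (L : fieldType) (g : {rmorphism R -> L}).

(** Injectivity of [g] keeps denominators nonzero, so a fraction can be evaluated in [L]. *)
Lemma fraction_lift : injective g ->
  exists f : {rmorphism {fraction R} -> L}, forall p, f (tofrac p) = g p.
Proof.
move=> g_inj.
have g_neq0 q : q != 0 -> g q != 0 by rewrite -(rmorph0 g) (inj_eq g_inj).
pose f x := g (fnum x) / g (fden x).
(* [f] may be computed from any fraction representing [x]; each morphism law below then needs only
   one convenient fraction. *)
have fE x p q : q != 0 -> x * tofrac q = tofrac p -> f x = g p / g q.
  move=> q0 xq; apply/eqP; rewrite eqr_div ?g_neq0 ?fden_neq0 //.
  rewrite -!rmorphM; apply/eqP; congr (g _); apply/eqP.
  by rewrite -tofrac_eq !tofracM -xq -mul_fden mulrAC.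
have fB : zmod_morphism f.
  move=> x y.
  rewrite (fE _ (fnum x * fden y - fnum y * fden x) (fden x * fden y)).
  - rewrite /f rmorphB !rmorphM.
    by field; rewrite !g_neq0 ?fden_neq0.
  - by rewrite mulf_neq0 ?fden_neq0.
  - by rewrite tofracB !tofracM -!mul_fden; ring.
have fM : monoid_morphism f.
  split; first by rewrite (fE _ 1 1) ?oner_neq0 ?rmorph1 ?mulr1 ?divr1.
  move=> x y; rewrite (fE _ (fnum x * fnum y) (fden x * fden y)).
  - by rewrite /f !rmorphM mulf_div.
  - by rewrite mulf_neq0 ?fden_neq0.
  - by rewrite !tofracM -!mul_fden mulrACA.
pose fA := GRing.isZmodMorphism.Build _ _ f fB.
pose fR := GRing.isMonoidMorphism.Build _ _ f fM.
pose F : {rmorphism {fraction R} -> L} := HB.pack f fA fR.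
exists F => p; rewrite /F /= (fE _ p 1) ?oner_neq0 //.
  by rewrite rmorph1 divr1.
by rewrite tofrac1 mulr1.
Qed.

End FractionLift.

Lemma eq_fraction_rmorph (R : idomainType) (L : fieldType)
    (f g : {rmorphism {fraction R} -> L}) :
  (forall p, f (tofrac p) = g (tofrac p)) -> f =1 g.
Proof.
move=> fg x; by rewrite (fraction_quotient x) !fmorph_div !fg.
Qed.

(** * Specialization of fractions along a ring morphism *)

Section Specialization.
Variables (R : idomainType) (s : {rmorphism R -> {fraction R}}).

(* [y] is the value of [x] under [s], which need not be injective: [x] is
   required to have a denominator that [s] does not kill. *)
Definition specializes (x y : {fraction R}) : Prop :=
  exists p q, [/\ s q != 0, x * tofrac q = tofrac p & y * s q = s p].

Lemma specializes_tofrac p : specializes (tofrac p) (s p).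
Proof.
by exists p, 1; rewrite tofrac1 (rmorph1 s) !mulr1 oner_neq0.
Qed.

Lemma specializes1 : specializes 1 1.
Proof. by have := specializes_tofrac 1; rewrite tofrac1 (rmorph1 s). Qed.

Lemma specializesD x y x' y' :
  specializes x y -> specializes x' y' -> specializes (x + x') (y + y').
Proof.
move=> [p [q [q0 xq yq]]] [p' [q' [q'0 xq' yq']]].
exists (p * q' + p' * q), (q * q'); split.
- by rewrite (rmorphM s) mulf_neq0.
- by rewrite tofracD !tofracM -xq -xq'; ring.
- by rewrite (rmorphD s) !(rmorphM s) -yq -yq'; ring.
Qed.

Lemma specializesM x y x' y' :
  specializes x y -> specializes x' y' -> specializes (x * x') (y * y').
Proof.
move=> [p [q [q0 xq yq]]] [p' [q' [q'0 xq' yq']]].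
exists (p * p'), (q * q'); split.
- by rewrite (rmorphM s) mulf_neq0.
- by rewrite !tofracM -xq -xq' mulrACA.
- by rewrite !(rmorphM s) -yq -yq' mulrACA.
Qed.

Lemma specializesN x y : specializes x y -> specializes (- x) (- y).
Proof.
move=> sxy; rewrite -[- x]mulN1r -[- y]mulN1r; apply: specializesM sxy.
by have := specializes_tofrac (- 1); rewrite tofracN tofrac1 (rmorphN1 s).
Qed.

Lemma specializesB x y x' y' :
  specializes x y -> specializes x' y' -> specializes (x - x') (y - y').
Proof. by move=> sxy sxy'; apply/specializesD/specializesN. Qed.

(** A nonzero value forces the numerator to survive [s], so it can become the denominator of the
    inverse. *)
Lemma specializesV x y : y != 0 -> specializes x y -> specializes x^-1 y^-1.
Proof.
move=> y0 [p [q [q0 xq yq]]].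
have p0 : s p != 0 by rewrite -yq mulf_neq0.
have Fp0 : tofrac p != 0.
  by rewrite tofrac_eq0; apply: contraNneq p0 => ->; rewrite (rmorph0 s).
have x0 : x != 0 by apply: contraNneq Fp0 => x0; rewrite -xq x0 mul0r.
by exists q, p; split; rewrite // -?xq -?yq mulKf.
Qed.

Lemma specializes_div x y x' y' : y' != 0 ->
  specializes x y -> specializes x' y' -> specializes (x / x') (y / y').
Proof. by move=> y'0 sxy sxy'; apply/specializesM/specializesV. Qed.

(** A fraction equal to zero has numerator zero, while [s] keeps its denominator nonzero. This is
    how [subst_inj] turns specialization into injectivity. *)
Lemma specializes0 y : specializes 0 y -> y = 0.
Proof.
move=> [p [q [q0 /esym/eqP]]]; rewrite mul0r tofrac_eq0 => /eqP->.
by rewrite (rmorph0 s) => /eqP; rewrite mulf_eq0 (negPf q0) orbF => /eqP.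
Qed.

End Specialization.

(** * Substitution of rational functions for indeterminates *)

HB.lock Definition subst (n : nat) (K : fieldType)
    (h : 'I_n -> {fraction {mpoly K[n]}}) :
    {rmorphism {mpoly K[n]} -> {fraction {mpoly K[n]}}} :=
  mmap (@tofrac {mpoly K[n]} \o @mpolyC n K) h.

Section RationalSubstitution.
Variables (n : nat) (K : fieldType).
Local Notation ratfun := {fraction {mpoly K[n]}}.
Implicit Types (h k : 'I_n -> ratfun) (p q : {mpoly K[n]}).

Lemma substX h i : subst h 'X_i = h i.
Proof. by rewrite subst.unlock /= mmapX mmap1U. Qed.

Lemma substC h c : subst h c%:MP = tofrac c%:MP.
Proof. by rewrite subst.unlock /= mmapC. Qed.

Lemma specializesX h i : specializes (subst h) (tofrac 'X_i) (h i).
Proof. by rewrite -(substX h); apply: specializes_tofrac. Qed.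

(** Every monomial is a product of powers of indeterminates, so constants and indeterminates
    generate the ring. *)
Lemma mpoly_genind (P : {mpoly K[n]} -> Prop) :
  (forall c, P c%:MP) -> (forall i, P 'X_i) ->
  (forall p q, P p -> P q -> P (p + q)) ->
  (forall p q, P p -> P q -> P (p * q)) -> forall p, P p.
Proof.
move=> PC PX PD PM; elim/mpolyind=> [|c m p _ _ Pp]; first by rewrite -mpolyC0.
apply: PD => //; rewrite -mul_mpolyC; apply: (PM) => //.
rewrite mpolyXE_id; apply: (big_ind P) => // [|i _]; first by rewrite -mpolyC1.
elim: (m i) => [|d IHd]; first by rewrite expr0 -mpolyC1.
by rewrite exprS; apply: PM.
Qed.

(* If [k] undoes [h], then it specializes [subst h p] back to [p]. *)
Lemma subst_inj h k :
  (forall i, specializes (subst k) (h i) (tofrac 'X_i)) -> injective (subst h).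
Proof.
move=> hk.
have spec p : specializes (subst k) (subst h p) (tofrac p).
  elim/mpoly_genind: p => [c|i|p q sp sq|p q sp sq].
  - by rewrite substC -{2}(substC k); apply: specializes_tofrac.
  - by rewrite substX.
  - by rewrite (rmorphD (subst h)) tofracD; apply: specializesD.
  - by rewrite (rmorphM (subst h)) tofracM; apply: specializesM.
move=> p q /eqP; rewrite -subr_eq0 -rmorphB => /eqP hpq.
have := spec (p - q); rewrite hpq => /specializes0 /eqP.
by rewrite tofrac_eq0 subr_eq0 => /eqP.
Qed.

(** [g \o f] fixes constants and indeterminates, hence all polynomials, hence all their
    quotients. *)
Lemma ratfun_cancel (f g : {rmorphism ratfun -> ratfun}) h :
  (forall p, f (tofrac p) = subst h p) ->
  (forall c, g (tofrac c%:MP) = tofrac c%:MP) ->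
  (forall i, g (h i) = tofrac 'X_i) -> cancel f g.
Proof.
move=> fh gC gh.
apply: (@eq_fraction_rmorph _ _ (g \o f) idfun) => p /=; rewrite fh.
elim/mpoly_genind: p => [c|i|p q gp gq|p q gp gq].
- by rewrite substC.
- by rewrite substX.
- by rewrite (rmorphD (subst h)) tofracD rmorphD gp gq.
- by rewrite (rmorphM (subst h)) tofracM rmorphM gp gq.
Qed.

End RationalSubstitution.

(** * The birational change of variables over an arbitrary field *)

Section ChangeOfVariables.
Variable F : fieldType.
Implicit Types a b c : F.

(** With the variables as arguments, one list describes both the generators and their images; at the
    indeterminates it is convertible to [U3_gens]. *)
Definition U3_seq a b c : seq F :=
  [:: -1; a; b; c; a - 1; b - 1; c - 1; a - b; a - c; b - c].

Definition H5_seq a b c : seq F :=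
  [:: -1; a; b; c; 1 - a; 1 - b; 1 - c; a - c; c - a * b;
      1 - c - (1 - a) * b].

(** The arguments of [alpha_of] and [gamma_of] stand for a1 and a2, those of [a1_of] and [a2_of] for
    alpha and gamma. *)
Definition alpha_of a b : F := (b - 1) / (b - a).
Definition gamma_of a b : F := a * (b - 1) / (b - a).
Definition a1_of a c : F := c / a.
Definition a2_of a c : F := (1 - c) / (1 - a).

Lemma U3_seq_neq0 a b c : 0 \notin U3_seq a b c ->
  [/\ a - 1 != 0, b - 1 != 0, b - a != 0 & a - b != 0].
Proof.
move/memPn=> nz; split; last 2 [rewrite -opprB oppr_eq0]; apply: nz.
all: by rewrite !inE ?opprB eqxx ?orbT.
Qed.

Lemma H5_seq_neq0 a b c : 0 \notin H5_seq a b c ->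
  [/\ a != 0, 1 - a != 0 & a - c != 0].
Proof. by move/memPn=> nz; split; apply: nz; rewrite !inE eqxx ?orbT. Qed.

Lemma of_U3K a b c : 0 \notin U3_seq a b c ->
  [/\ alpha_of a b != 0, 1 - alpha_of a b != 0,
      a1_of (alpha_of a b) (gamma_of a b) = a
    & a2_of (alpha_of a b) (gamma_of a b) = b].
Proof.
move=> /U3_seq_neq0[a1 b1 ba _]; rewrite /a1_of /a2_of /gamma_of.
(* This factorization reduces the nonvanishing of the denominator of [a2_of] to that of the
   generator [a - 1]. *)
have alpha1 : 1 - alpha_of a b = - (a - 1) / (b - a).
  by rewrite /alpha_of; field.
rewrite alpha1 /alpha_of !(mulf_neq0, invr_neq0, oppr_eq0) //.
by split=> //; field; rewrite ba ?oppr_eq0 ?b1.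
Qed.

Lemma of_H5K a b c : 0 \notin H5_seq a b c ->
  [/\ a2_of a c - a1_of a c != 0,
      alpha_of (a1_of a c) (a2_of a c) = a
    & gamma_of (a1_of a c) (a2_of a c) = c].
Proof.
move=> /H5_seq_neq0[a0 a1 ac]; rewrite /alpha_of /gamma_of.
have a12 : a2_of a c - a1_of a c = (a - c) / (a * (1 - a)).
  by rewrite /a2_of /a1_of; field; rewrite a0 a1.
rewrite a12 /a2_of /a1_of !(mulf_neq0, invr_neq0) //.
by split=> //; field; rewrite a0 a1.
Qed.

Ltac generated_product :=
  repeat (apply: generatedM || apply: generatedV);
  by apply: generated_mem; rewrite !inE eqxx ?orbT.

(** Since [gamma_of a b = a * alpha_of a b] and [1 - gamma_of a b = b * (1 - alpha_of a b)], the
    last two Hydra-5 generators become [alpha_of a b * (a - c)] and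
    [(1 - alpha_of a b) * (b - c)]. *)
Lemma H5_seq_generated a b c : 0 \notin U3_seq a b c ->
  forall x, x \in H5_seq (alpha_of a b) c (gamma_of a b) ->
  generated (U3_seq a b c) x.
Proof.
move=> /U3_seq_neq0[a1 b1 ba ab] x; rewrite /alpha_of /gamma_of.
rewrite in_cons => /predU1P[->|]; first by generated_product.
(* The listed generator is [a - b], so the sign is moved into the generator [-1]. *)
have -> : (b - 1) / (b - a) = -1 * (b - 1) / (a - b) by (field; rewrite ab).
have -> : a * (b - 1) / (b - a) = -1 * a * (b - 1) / (a - b)
  by (field; rewrite ab).
rewrite !inE; do !case/predU1P=> [->|]; last move/eqP=> ->.
- generated_product.
- generated_product.
- generated_product.
- rewrite (_ : 1 - _ = (a - 1) / (a - b)); last by field.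
  generated_product.
- rewrite -opprB -mulN1r; generated_product.
- rewrite (_ : 1 - _ = b * (a - 1) / (a - b)); last by field.
  generated_product.
- rewrite (_ : _ - _ = (b - 1) * (a - 1) / (a - b)); last by field.
  generated_product.
- rewrite (_ : _ - _ = -1 * (b - 1) * (a - c) / (a - b));
    last by field.
  generated_product.
- rewrite (_ : _ - _ = (a - 1) * (b - c) / (a - b)); last by field.
  generated_product.
Qed.

(** The generators a1 - 1, a2 - 1 and a1 - a2 all come from [a - c]; the two differences with a3
    come from the last two Hydra-5 generators. *)
Lemma U3_seq_generated a b c : 0 \notin H5_seq a b c ->
  forall x, x \in U3_seq (a1_of a c) (a2_of a c) b ->
  generated (H5_seq a b c) x.
Proof.
move=> /H5_seq_neq0[a0 a1 ac] x; rewrite /a1_of /a2_of.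
rewrite !inE; do !case/predU1P=> [->|]; last move/eqP=> ->.
- generated_product.
- generated_product.
- generated_product.
- generated_product.
- rewrite (_ : _ - _ = -1 * (a - c) / a); last by field.
  generated_product.
- rewrite (_ : _ - _ = (a - c) / (1 - a)); last by field.
  generated_product.
- rewrite -opprB -mulN1r; generated_product.
- rewrite (_ : _ - _ = -1 * (a - c) / a / (1 - a));
    last by (field; rewrite a0 a1).
  generated_product.
- rewrite (_ : _ - _ = (c - a * b) / a); last by field.
  generated_product.
- rewrite (_ : _ - _ = (1 - c - (1 - a) * b) / (1 - a)); last by field.
  generated_product.
Qed.

End ChangeOfVariables.

(** * Compatibility of the formulas with morphisms and with specialization *)

Section SeqRmorphism.
Variables (F L : fieldType) (f : {rmorphism F -> L}).

Lemma map_U3_seq a b c :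
  map f (U3_seq a b c) = U3_seq (f a) (f b) (f c).
Proof. by rewrite /= !rmorphB rmorphN rmorph1. Qed.

Lemma map_H5_seq a b c :
  map f (H5_seq a b c) = H5_seq (f a) (f b) (f c).
Proof. by rewrite /= !rmorphB !rmorphM !rmorphB rmorphN rmorph1. Qed.

Lemma rmorph_alpha_of a b : f (alpha_of a b) = alpha_of (f a) (f b).
Proof. by rewrite /alpha_of fmorph_div !rmorphB rmorph1. Qed.

Lemma rmorph_gamma_of a b : f (gamma_of a b) = gamma_of (f a) (f b).
Proof. by rewrite /gamma_of fmorph_div rmorphM !rmorphB rmorph1. Qed.

Lemma rmorph_a1_of a c : f (a1_of a c) = a1_of (f a) (f c).
Proof. exact: fmorph_div. Qed.

Lemma rmorph_a2_of a c : f (a2_of a c) = a2_of (f a) (f c).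
Proof. by rewrite /a2_of fmorph_div !rmorphB rmorph1. Qed.

End SeqRmorphism.

Section SpecializeSubstitutions.
Variables (R : idomainType) (s : {rmorphism R -> {fraction R}}).
Variables a a' b b' : {fraction R}.
Hypotheses (sa : specializes s a a') (sb : specializes s b b').

Lemma specializes_alpha_of : b' - a' != 0 ->
  specializes s (alpha_of a b) (alpha_of a' b').
Proof.
by move=> ?; apply: specializes_div => //; apply: specializesB => //;
  apply: specializes1.
Qed.

Lemma specializes_gamma_of : b' - a' != 0 ->
  specializes s (gamma_of a b) (gamma_of a' b').
Proof.
move=> ?; apply: specializes_div => //; last exact: specializesB.
by apply: specializesM => //; apply: specializesB => //; apply: specializes1.
Qed.

Lemma specializes_a1_of : a' != 0 ->
  specializes s (a1_of a b) (a1_of a' b').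
Proof. by move=> ?; apply: specializes_div. Qed.

Lemma specializes_a2_of : 1 - a' != 0 ->
  specializes s (a2_of a b) (a2_of a' b').
Proof.
by move=> ?; apply: specializes_div => //; apply: specializesB => //;
  apply: specializes1.
Qed.

End SpecializeSubstitutions.

(** * The two substitutions and the resulting automorphisms *)

Local Notation x0 := (indet (inord 0)).
Local Notation x1 := (indet (inord 1)).
Local Notation x2 := (indet (inord 2)).

Lemma U3_seq_indet : 0 \notin U3_seq x0 x1 x2.
Proof. exact: U3_gens_neq0. Qed.

Lemma H5_seq_indet : 0 \notin H5_seq x0 x1 x2.
Proof. exact: H5_gens_neq0. Qed.

Lemma I3_ind (P : 'I_3 -> Prop) :
  P (inord 0) -> P (inord 1) -> P (inord 2) -> forall i, P i.
Proof.
by move=> P0 P1 P2 i; rewrite -[i]inord_val; case: i => [[|[|[|//]]]] /=.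
Qed.

(** The same indeterminates serve as alpha, beta, gamma in the source and as a1, a2, a3 in the
    target, so beta, at index 1, goes to [x2]. *)
Definition H5_to_U3 (i : 'I_3) : ratfun3 :=
  [:: alpha_of x0 x1; x2; gamma_of x0 x1]`_i.

Definition U3_to_H5 (i : 'I_3) : ratfun3 :=
  [:: a1_of x0 x2; a2_of x0 x2; x1]`_i.

Lemma H5_to_U3E :
  [/\ H5_to_U3 (inord 0) = alpha_of x0 x1, H5_to_U3 (inord 1) = x2
    & H5_to_U3 (inord 2) = gamma_of x0 x1].
Proof. by rewrite /H5_to_U3 !inordK. Qed.

Lemma U3_to_H5E :
  [/\ U3_to_H5 (inord 0) = a1_of x0 x2, U3_to_H5 (inord 1) = a2_of x0 x2
    & U3_to_H5 (inord 2) = x1].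
Proof. by rewrite /U3_to_H5 !inordK. Qed.

(** [U3_to_H5] specializes each image back to its indeterminate, by the identities of [of_H5K].
    Specialization avoids a circle: [U3_to_H5] is not yet known to extend to fractions. *)
Lemma H5_to_U3_inj : injective (subst H5_to_U3).
Proof.
have [h0 h1 h2] := H5_to_U3E; have [k0 k1 k2] := U3_to_H5E.
have [k10 alphaK gammaK] := of_H5K H5_seq_indet.
have s_x0 := specializesX U3_to_H5 (inord 0); rewrite k0 in s_x0.
have s_x1 := specializesX U3_to_H5 (inord 1); rewrite k1 in s_x1.
have s_x2 := specializesX U3_to_H5 (inord 2); rewrite k2 in s_x2.
have s_alpha := specializes_alpha_of s_x0 s_x1 k10; rewrite alphaK in s_alpha.
have s_gamma := specializes_gamma_of s_x0 s_x1 k10; rewrite gammaK in s_gamma.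
apply: (subst_inj (k := U3_to_H5)); apply: I3_ind.
- by rewrite h0.
- by rewrite h1.
- by rewrite h2.
Qed.

Lemma U3_to_H5_inj : injective (subst U3_to_H5).
Proof.
have [h0 h1 h2] := H5_to_U3E; have [k0 k1 k2] := U3_to_H5E.
have [alpha0 alpha1 a1K a2K] := of_U3K U3_seq_indet.
have s_x0 := specializesX H5_to_U3 (inord 0); rewrite h0 in s_x0.
have s_x1 := specializesX H5_to_U3 (inord 1); rewrite h1 in s_x1.
have s_x2 := specializesX H5_to_U3 (inord 2); rewrite h2 in s_x2.
have s_a1 := specializes_a1_of s_x0 s_x2 alpha0; rewrite a1K in s_a1.
have s_a2 := specializes_a2_of s_x0 s_x2 alpha1; rewrite a2K in s_a2.
apply: (subst_inj (k := H5_to_U3)); apply: I3_ind.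
- by rewrite k0.
- by rewrite k1.
- by rewrite k2.
Qed.

Lemma H5_U3_automorphisms :
  exists f g : {rmorphism ratfun3 -> ratfun3},
  [/\ cancel f g, cancel g f,
      forall x, generated H5_gens x -> generated U3_gens (f x)
    & forall x, generated U3_gens x -> generated H5_gens (g x)].
Proof.
have [h0 h1 h2] := H5_to_U3E; have [k0 k1 k2] := U3_to_H5E.
have [_ alphaK gammaK] := of_H5K H5_seq_indet.
have [_ _ a1K a2K] := of_U3K U3_seq_indet.
have [f fE] := fraction_lift H5_to_U3_inj.
have [g gE] := fraction_lift U3_to_H5_inj.
have fX i : f (indet i) = H5_to_U3 i by rewrite /indet fE substX.
have gX i : g (indet i) = U3_to_H5 i by rewrite /indet gE substX.
have fC c : f (tofrac c%:MP) = tofrac c%:MP by rewrite fE substC.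
have gC c : g (tofrac c%:MP) = tofrac c%:MP by rewrite gE substC.
exists f, g; split.
- apply: (ratfun_cancel fE gC); apply: I3_ind; rewrite -/(indet _).
  + by rewrite h0 rmorph_alpha_of !gX k0 k1.
  + by rewrite h1 gX k2.
  + by rewrite h2 rmorph_gamma_of !gX k0 k1.
- apply: (ratfun_cancel gE fC); apply: I3_ind; rewrite -/(indet _).
  + by rewrite k0 rmorph_a1_of !fX h0 h2.
  + by rewrite k1 rmorph_a2_of !fX h0 h2.
  + by rewrite k2 fX h1.
(* [f] maps the generator list to the same list at the substituted values, where the explicit
   factorizations apply. *)
- apply: generated_rmorph => x /(map_f f).
  by rewrite map_H5_seq !fX h0 h1 h2; apply: H5_seq_generated U3_seq_indet _.
- apply: generated_rmorph => x /(map_f g).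
  by rewrite map_U3_seq !gX k0 k1 k2; apply: U3_seq_generated H5_seq_indet _.
Qed.

Theorem lemma2p25 :
  pf_isomorphic H5 U3 /\
  (forall (E : finType) (M : matroid E),
     three_regular M <-> representable H5 M).
Proof.
have [f [g [fK gK fG gG]]] := H5_U3_automorphisms.
split; first exact: (@pf_isomorphic_rmorph H5 U3 f g).
move=> E M; split.
- exact: (@representable_rmorph U3 H5 g gG (can_inj gK)).
- exact: (@representable_rmorph H5 U3 f fG (can_inj fK)).
Qed.
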